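(* Let $R$ be a finite chain ring and $S$ its Galois extension of rank $m$ with automorphism $\sigma$, as in the context. Let $a_1,\ldots,a_\ell\in S^*$ be such that $a_i-a_j^\beta\in S^*$ for all $\beta\in S^*$ and all $1\le i<j\le\ell$. Then for every non-zero monic skew polynomial $F\in S[x;\sigma]$, $$\sum_{i=1}^\ell {\rm frk}_R\big(F_{a_i}^{-1}(\mathfrak{M})\big)\le \deg(F),$$ where $F_{a_i}^{-1}(\mathfrak{M})=\{\beta\in S: F_{a_i}(\beta)\in\mathfrak{M}\}$.
   Context: $R$ is a finite commutative chain ring with maximal ideal $\mathfrak{m}$, $q=|R/\mathfrak{m}|$. $S=R[x]/(h)$ with $h\in R[x]$ monic of degree $m$ and irreducible modulo $\mathfrak{m}$; $S$ is local with maximal ideal $\mathfrak{M}=\mathfrak{m}S$, unit group $S^*=S\setminus\mathfrak{M}$, and $S/\mathfrak{M}=\mathbb{F}_{q^m}$. $\sigma$ is a ring automorphism of $S$ generating the Galois group of $R\subseteq S$ (fixed ring $R$), reducing modulo $\mathfrak{M}$ to $y\mapsto y^q$. $S[x;\sigma]$ is the skew polynomial ring with $xa=\sigma(a)x$ for $a\in S$. For $a\in S$, $N_i(a)=\sigma^{i-1}(a)\cdots\sigma(a)a$, $\mathcal{D}_a^i(\beta)=\sigma^i(\beta)N_i(a)$, and for $F=\sum_i F_ix^i$, $F_a(\beta)=\sum_iF_i\mathcal{D}_a^i(\beta)$ (an $R$-linear map $S\to S$). For $\beta\in S^*$, $a^\beta=\sigma(\beta)a\beta^{-1}$. For an $R$-module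 $M$ (or subset of $S$), ${\rm frk}_R(M)$ is the maximum size of an $R$-linearly independent subset of $M$. *)

(* Defs.v *)
From HB Require Import structures.
From mathcomp Require Import all_boot all_order all_algebra.
Set Implicit Arguments. Unset Strict Implicit. Unset Printing Implicit Defensive.
Import Order.TTheory GRing.Theory.
Local Open Scope ring_scope.

Section Defs.
Variables (R S : finComUnitRingType) (iota : {rmorphism R -> S}).

Definition is_ideal (I : {set R}) : Prop :=
  0 \in I /\ (forall x y, x \in I -> y \in I -> x + y \in I) /\
  (forall r x, x \in I -> r * x \in I).

Definition chain_ring : Prop :=
  forall I J : {set R}, is_ideal I -> is_ideal J -> I \subset J \/ J \subset I.

Definition maxid : {set R} := [set r : R | r \isn't a GRing.unit].
Definition MaxId : {set S} := [set s : S | s \isn't a GRing.unit].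

(* q = |R / m| *)
Definition resq : nat := (#|[set: R]| %/ #|maxid|)%N.

(* h irreducible modulo m: its reduction in (R/m)[x] is irreducible, i.e.
   any factorisation h = f g mod m has a factor which is constant mod m. *)
Definition irred_mod (h : {poly R}) : Prop :=
  forall f g : {poly R}, (forall i, (h - f * g)`_i \in maxid) ->
    (forall i, (0 < i)%N -> f`_i \in maxid) \/
    (forall i, (0 < i)%N -> g`_i \in maxid).

Definition R_lin_indep (B : {set S}) : bool :=
  [forall c : {ffun S -> R},
    (\sum_(b in B) iota (c b) * b == 0) ==> [forall b in B, c b == 0]].

Definition frk (A : {set S}) : nat :=
  \max_(B : {set S} | (B \subset A) && R_lin_indep B) #|B|.

Variable sigma : S -> S.

Definition Nsk (i : nat) (a : S) : S := \prod_(k < i) iter k sigma a.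
Definition Dsk (a : S) (i : nat) (beta : S) : S := iter i sigma beta * Nsk i a.
(* F_a(beta) = sum_i F_i D_a^i(beta), F given by its coefficients F_0..F_d *)
Definition skew_eval (F : {poly S}) (a beta : S) : S :=
  \sum_(i < size F) F`_i * Dsk a i beta.
Definition sconj (a beta : S) : S := sigma beta * a * beta^-1.

End Defs.

(* Main.v *)
(* Let p generate m, with p^(n+1) = 0 and e := p^n nonzero. Then m and M are the
   annihilators of e in R and S, so that congruences modulo M are equations of
   the form e * x = 0 and R-independent elements of S stay independent modulo M.
   If F has a root b modulo M at a_i, with b a unit, divide F on the right by
   'X - c, where c is the conjugate of a_i by b. The remainder vanishes
   modulo M, and the quotient has roots sigma x * a_j - c * x at a_j for each
   root x of F at a_j. Modulo M this additive map is injective for j <> i by the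
   non-conjugacy hypothesis, and its kernel for j = i is the residue line of b,
   because the fixed field of the Frobenius is R/m. Hence the total number of
   independent roots drops by one with the degree. *)
Require Import Defs.
From HB Require Import structures.
From mathcomp Require Import all_boot all_order all_algebra.
From mathcomp Require Import all_fingroup cyclic ring.
Import GRing.Theory.
Local Open Scope ring_scope.

(** * Finite chain rings: uniformizer and socle *)

Lemma finite_sequence_repeats (T : finType) (x : nat -> T) :
  exists j k, (j < k)%N /\ x j = x k.
Proof.
have /injectivePn [i [j ne_ij eq_x]] :
    ~~ injectiveb (fun i : 'I_#|T|.+1 => x i).
  apply/negP => /injectiveP inj_x.
  by have := leq_card _ inj_x; rewrite card_ord ltnn.
case: (ltngtP i j) => [lt_ij|lt_ji|/ord_inj eq_ij].
- by exists i, j.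
- by exists j, i.
- by rewrite eq_ij eqxx in ne_ij.
Qed.

(** By finiteness [x j = x k] for some j < k. As [x k] is [x j] times a multiple of [t j], this
    reads [x j * (1 - t j * v) = 0] with a unit factor. *)
Lemma descent_vanishes (A : finComUnitRingType) (x t : nat -> A) :
  (forall j, x j.+1 = x j * t j) ->
  (forall j u, 1 - t j * u \is a GRing.unit) ->
  exists j, x j = 0.
Proof.
move=> xS t_rad; have [j [k [lt_jk eq_x]]] := finite_sequence_repeats _ x.
exists j.
have [v xk] : exists v, x k = x j * (t j * v).
  elim: k lt_jk {eq_x} => // k IH; rewrite ltnS leq_eqVlt.
  case/orP => [/eqP <-|/IH [v {}IH]].
    by exists 1; rewrite mulr1 xS.
  by exists (v * t k); rewrite xS IH !mulrA.
have /(mulIr (t_rad j v)) // : x j * (1 - t j * v) = 0 * (1 - t j * v).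
by rewrite mulrBr mulr1 -xk -eq_x subrr mul0r.
Qed.

Lemma chain_ring_comparable (R : finComUnitRingType) (x y : R) :
  chain_ring R -> (exists z, x = y * z) \/ (exists z, y = x * z).
Proof.
pose I (c : R) := [set c * z | z : R].
have idealI c : is_ideal (I c).
  split; first by apply/imsetP; exists 0; rewrite ?inE ?mulr0.
  split=> [u v /imsetP [z _ ->] /imsetP [w _ ->]|r u /imsetP [z _ ->]].
    by apply/imsetP; exists (z + w); rewrite ?inE ?mulrDr.
  by apply/imsetP; exists (r * z); rewrite ?inE // mulrCA.
have mem_I c : c \in I c by apply/imsetP; exists 1; rewrite ?inE ?mulr1.
move=> /(_ _ _ (idealI x) (idealI y)) [] /subsetP sub.
  by left; have /imsetP [z _ ->] := sub _ (mem_I x); exists z.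
by right; have /imsetP [z _ ->] := sub _ (mem_I y); exists z.
Qed.

(** A nonunit generating a principal ideal of maximal cardinality works, since principal ideals are
    comparable. *)
Lemma chain_ring_uniformizer (R : finComUnitRingType) :
  chain_ring R ->
  exists2 p : R, p \isn't a GRing.unit &
    forall c, c \isn't a GRing.unit -> exists z, c = p * z.
Proof.
move=> chR.
have zeroNU : (0 : R) \isn't a GRing.unit by rewrite unitr0.
case: (@arg_maxnP R 0 (fun p => p \isn't a GRing.unit)
  (fun p => #|[set p * z | z : R]|) zeroNU) => p pNU p_max.
exists p => // c cNU; case: (chain_ring_comparable _ c p chR) => // -[z def_p].
have sub_pc : [set p * z | z : R] \subset [set c * z | z : R].
  apply/subsetP => _ /imsetP [w _ ->].
  by apply/imsetP; exists (z * w); rewrite ?inE // def_p mulrA.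
have /eqP eq_pc : [set p * z | z : R] == [set c * z | z : R].
  by rewrite eqEcard sub_pc; apply: p_max.
have : c \in [set p * z | z : R].
  by rewrite eq_pc; apply/imsetP; exists 1; rewrite ?inE ?mulr1.
by case/imsetP=> w _ ->; exists w.
Qed.

Lemma uniformizer_socle (R : finComUnitRingType) (p : R) :
  p \isn't a GRing.unit ->
  (forall c, c \isn't a GRing.unit -> exists z, c = p * z) ->
  exists2 n, p ^+ n.+1 = 0 & p ^+ n != 0.
Proof.
move=> pNU p_gen.
have p_rad u : 1 - p * u \is a GRing.unit.
  apply/negPn/negP => /p_gen [z def_z].
  have : p * (u + z) \is a GRing.unit by rewrite mulrDr -def_z addrC subrK unitr1.
  by rewrite unitrM (negPf pNU).
have [j pj0] := descent_vanishes _ (fun j => p ^+ j) (fun=> p)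
  (fun j => exprSr p j) (fun=> p_rad).
have p_nil : exists n, p ^+ n == 0 by exists j; apply/eqP.
case: (ex_minnP p_nil) => -[|n] /eqP pn0 n_min.
  by have /eqP := oner_neq0 R; rewrite -(expr0 p) pn0.
by exists n => //; apply/negP => /n_min; rewrite ltnn.
Qed.

(** * Units of S through the irreducibility of h modulo m *)

Lemma one_sub_nilpotent_unit (A : comUnitRingType) (p u : A) n :
  p ^+ n = 0 -> 1 - p * u \is a GRing.unit.
Proof.
move=> pn0; have := subrXX 1 (p * u) n; rewrite exprMn pn0 mul0r expr1n subr0.
by move=> /esym/(congr1 (fun x => x \is a GRing.unit)); rewrite unitr1 unitrM => /andP [].
Qed.

Lemma monic_const_mod (R : unitRingType) (g : {poly R}) :
  g \is monic -> (forall i, (0 < i)%N -> g`_i \isn't a GRing.unit) -> g = 1.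
Proof.
move=> g_monic gNU; have [le_g1|lt_1g] := leqP (size g) 1.
  have := g_monic; rewrite (size1_polyC le_g1) monicE lead_coefC => /eqP ->.
  by rewrite polyC1.
have := gNU (size g).-1; rewrite -subn1 subn_gt0 lt_1g subn1 => /(_ isT).
by have /monicP := g_monic; rewrite /lead_coef => ->; rewrite unitr1.
Qed.

Section ResidueDomain.
Variables (R S : finComUnitRingType) (iota : {rmorphism R -> S}).
Variables (h : {poly R}) (xi : S) (p : R) (n : nat).
Hypotheses (h_monic : h \is monic) (h_irr : irred_mod h).
Hypotheses (h_root : root (map_poly iota h) xi).
Hypotheses (p_nil : p ^+ n = 0).
Hypotheses (p_gen : forall c, c \isn't a GRing.unit -> exists z, c = p * z).

Lemma nonunit_coefs_eval (f : {poly R}) :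
  (forall i, f`_i \isn't a GRing.unit) ->
  exists t, (map_poly iota f).[xi] = iota p * t.
Proof.
move=> fNU; have le_size : (size (map_poly iota f) <= size f)%N by exact: size_poly.
rewrite (horner_coef_wide xi le_size).
have {le_size} coef_p i : exists t, (map_poly iota f)`_i * xi ^+ i = iota p * t.
  have [z def_z] := p_gen _ (fNU i).
  by exists (iota z * xi ^+ i); rewrite coef_map /= def_z rmorphM mulrA.
elim: (size f) => [|k [t IH]]; first by exists 0; rewrite big_ord0 mulr0.
have [u def_u] := coef_p k.
by exists (t + u); rewrite big_ord_recr /= IH def_u mulrDr.
Qed.

(* Among the polynomials of degree < deg h with a unit coefficient whose value at
   xi lies in (s, p), one of minimal degree is, up to a unit, monic and divides h
   modulo m; irreducibility of h makes it constant. *)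
Lemma unit_coef_eval_unit (s : S) (f : {poly R}) :
  (size f < size h)%N -> (exists i, f`_i \is a GRing.unit) ->
  (exists t u, (map_poly iota f).[xi] = s * t + iota p * u) ->
  s \is a GRing.unit.
Proof.
have coefU_dec (g : {poly R}) :
    (exists i, g`_i \is a GRing.unit) \/ (forall i, g`_i \isn't a GRing.unit).
  case: (boolP (has (fun c => c \is a GRing.unit) g)) => [/hasP|/hasPn gNU].
    by case=> _ /(nthP 0) [i _ <-] giU; left; exists i.
  right=> i; case: (ltnP i (size g)) => [lt_i|le_i]; first exact/gNU/mem_nth.
  by rewrite nth_default ?unitr0.
have [k] := ubnP (size f); elim: k f => // k IH f.
rewrite ltnS => le_fk lt_fh [i fiU] [t [u eval_f]].
have f_gt0 : (0 < size f)%N.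
  rewrite lt0n size_poly_eq0; apply: contraTneq fiU => ->.
  by rewrite coef0 unitr0.
have lcE : lead_coef f = f`_(size f).-1 by [].
case: (boolP (lead_coef f \is a GRing.unit)) => [lcU|lcNU].
  have f1_monic : (lead_coef f)^-1 *: f \is monic.
    rewrite monicE lead_coef_lreg ?mulVr //.
    by apply/mulrI; rewrite unitrV.
  set f1 := _ *: f in f1_monic.
  have size_f1 : size f1 = size f.
    by apply: lreg_size; apply/mulrI; rewrite unitrV.
  set g := Pdiv.CommonRing.rdivp h f1; set r := Pdiv.CommonRing.rmodp h f1.
  have h_eq : h = g * f1 + r by exact: Pdiv.RingMonic.rdivp_eq.
  have lt_r : (size r < size f1)%N.
    by apply: Pdiv.CommonRing.ltn_rmodpN0; apply: monic_neq0.
  (* Since h vanishes at xi, the value of [r] is a multiple of that of [f], modulo nothing else: it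
     stays in (s, p), and [r] is smaller. If [r] has no unit coefficient, then h = g * f1 modulo
     m. *)
  case: (coefU_dec r) => [rU|rNU].
    apply: (IH r) => //.
    - by apply: leq_trans lt_r _; rewrite size_f1.
    - by apply: ltn_trans lt_r _; rewrite size_f1.
    exists (- (map_poly iota g).[xi] * iota (lead_coef f)^-1 * t),
           (- (map_poly iota g).[xi] * iota (lead_coef f)^-1 * u).
    have -> : r = h - g * f1 by rewrite {1}h_eq addrC addKr.
    move/eqP: h_root.
    rewrite rmorphB rmorphM /= hornerD hornerN hornerM => ->.
    rewrite /f1 map_polyZ /= hornerZ eval_f.
    by ring.
  have [|f1_const|g_const] := h_irr f1 g.
  - by move=> j; rewrite inE {1}h_eq mulrC addrC addKr.
  - have f1_1 : f1 = 1.
      by apply: monic_const_mod => // j /f1_const; rewrite inE.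
    have := one_sub_nilpotent_unit _ (iota p) (iota (lead_coef f)^-1 * u) n.
    rewrite -rmorphXn p_nil rmorph0 => /(_ erefl).
    have -> : 1 - iota p * (iota (lead_coef f)^-1 * u)
            = s * (t * iota (lead_coef f)^-1).
      have := congr1 (fun g => (map_poly iota g).[xi]) f1_1.
      rewrite /= rmorph1 hornerC => <-.
      by rewrite /f1 map_polyZ /= hornerZ eval_f; ring.
    by rewrite unitrM => /andP [].
  - have lt_gf : (size r < size (g * f1)%R)%N.
      have g_neq0 : g != 0.
        apply: contraTneq lt_r => g0; rewrite -leqNgt size_f1 ltnW //.
        by rewrite (_ : r = h) // h_eq g0 mul0r add0r.
      apply: leq_trans lt_r _; rewrite size_Mmonic ?f1_monic //.
      by rewrite (polySpred g_neq0) addSn leq_addl.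
    have g_monic : g \is monic.
      rewrite monicE -(lead_coef_Mmonic _ f1_monic) -(lead_coefDl lt_gf) -h_eq.
      by rewrite -monicE.
    have g1 : g = 1.
      by apply: monic_const_mod => // j /g_const; rewrite inE.
    by move: lt_fh; rewrite h_eq g1 mul1r size_polyDl // size_f1 ltnn.
have coef_f' j : (f - lead_coef f *: 'X^((size f).-1))`_j
    = if j == (size f).-1 then 0 else f`_j.
  rewrite coefB coefZ coefXn; case: eqP => [->|_].
    by rewrite mulr1 subrr.
  by rewrite mulr0 subr0.
have size_f' : (size (f - lead_coef f *: 'X^((size f).-1))%R < size f)%N.
  rewrite -{2}(prednK f_gt0) ltnS; apply/leq_sizeP => j le_j.
  rewrite coef_f'; case: eqP => // ne_j; apply: nth_default.
  by rewrite -(prednK f_gt0) ltn_neqAle le_j eq_sym andbT; apply/eqP.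
apply: (IH (f - lead_coef f *: 'X^((size f).-1))).
- exact: leq_trans size_f' le_fk.
- exact: ltn_trans size_f' lt_fh.
- exists i; rewrite coef_f' ifN //.
  by apply: contraNneq lcNU => eq_i; rewrite lcE -eq_i.
have [z ->] := p_gen _ lcNU.
exists t, (u - iota z * xi ^+ (size f).-1).
rewrite rmorphB /= map_polyZ /= map_polyXn hornerD hornerN hornerZ hornerXn eval_f.
by rewrite rmorphM /=; ring.
Qed.
End ResidueDomain.

(** * Residue characteristic and fixed points of Frobenius *)

(** Lagrange in the additive group R/m, written multiplicatively: q times the class of 1 is zero. *)
Lemma residue_card_nonunit (R : finComUnitRingType) (e : R) :
  (forall c : R, (c \isn't a GRing.unit) = (e * c == 0)) ->
  ((resq R)%:R : R) \isn't a GRing.unit.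
Proof.
move=> nonunitE; have gH : group_set (maxid R).
  apply/group_setP; split=> [|x y]; rewrite !inE ?FinRing.zmod1gE ?unitr0 //.
  rewrite FinRing.zmodMgE !nonunitE mulrDr => /eqP -> /eqP ->.
  by rewrite addr0.
pose H := Group gH; pose G := [set: R]%G.
have normH : G \subset 'N(H)%g.
  apply: sub_abelian_norm; last exact: subsetT.
  by apply/centsP => x _ y _; rewrite /commute !FinRing.zmodMgE addrC.
have resqE : resq R = #|(G / H)%g|.
  by rewrite card_quotient // -divgS ?subsetT.
have one_norm : (1%R : R) \in 'N(H)%g by apply: (subsetP normH); rewrite inE.
have : ((1%R : R) ^+ resq R)%g \in H.
  apply: coset_idr; first exact: groupX.
  rewrite morphX // resqE expg_cardG // mem_quotient // inE.
by rewrite FinRing.zmodXgE inE.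
Qed.

Section SkewRoots.
Variables (R S : finComUnitRingType) (iota : {rmorphism R -> S}).
Variables (sigma : {rmorphism S -> S}) (e : R).
Hypotheses (e_neq0 : e != 0) (iota_inj : injective iota).
Hypotheses (nonunitR : forall c : R, (c \isn't a GRing.unit) = (e * c == 0)).
Hypotheses (nonunitS :
  forall s : S, (s \isn't a GRing.unit) = (iota e * s == 0)).
Hypotheses (sigma_fix : forall r, sigma (iota r) = iota r).
Hypotheses (fix_sigma : forall s, sigma s = s -> exists r, s = iota r).
Hypotheses (frob :
  forall y : S, sigma y - y ^+ resq R \in MaxId S).

Lemma one_sub_nonunit_unit (t u : S) :
  t \isn't a GRing.unit -> 1 - t * u \is a GRing.unit.
Proof.
rewrite nonunitS => /eqP et0; apply/negPn/negP.
rewrite nonunitS mulrBr mulr1 mulrA et0 mul0r subr0.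
by rewrite -(rmorph0 iota) (inj_eq iota_inj) (negPf e_neq0).
Qed.

(* The q^N-th power of u, for N large, is a lift of the residue class of u that
   is fixed by sigma, as q-th powers bring congruent elements closer together. *)
Lemma sigma_fixed_mod (u : S) :
  iota e * (sigma u - u) = 0 -> exists r, iota e * (u - iota r) = 0.
Proof.
move=> sig_u; pose q := resq R.
have q_neq0 : iota e * q%:R = 0.
  have := residue_card_nonunit _ _ nonunitR; rewrite nonunitR => /eqP eq0.
  by rewrite -(rmorph_nat iota) -rmorphM eq0 rmorph0.
have frobE y : iota e * sigma y = iota e * y ^+ q.
  by have := frob y; rewrite inE nonunitS mulrBr subr_eq0 => /eqP.
have powX (x y : S) k : iota e * x = iota e * y ->
    iota e * x ^+ k = iota e * y ^+ k.
  move=> exy; elim: k => // k IH.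
  by rewrite !exprS mulrA exy -mulrA mulrCA IH mulrCA.
pose d j := sigma u ^+ (q ^ j) - u ^+ (q ^ j).
pose t j := \sum_(i < q) (sigma u ^+ (q ^ j)) ^+ (q.-1 - i) * (u ^+ (q ^ j)) ^+ i.
have dS j : d j.+1 = d j * t j.
  by rewrite /d expnSr !exprM subrXX.
have sig_uE : iota e * sigma u = iota e * u.
  by apply/eqP; rewrite -subr_eq0 -mulrBr sig_u.
(* Modulo M the q summands of [t j] coincide, and q is zero there. *)
have t_nonunit j : t j \isn't a GRing.unit.
  rewrite nonunitS; apply/eqP; set v := u ^+ (q ^ j).
  have -> : iota e * t j = \sum_(i < q) iota e * v ^+ q.-1.
    rewrite mulr_sumr; apply: eq_bigr => i _.
    have le_i : (i <= q.-1)%N by rewrite -ltnS (ltn_predK (ltn_ord i)).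
    rewrite mulrA (powX _ v); last exact: powX.
    by rewrite -mulrA -exprD subnK.
  by rewrite sumr_const card_ord -mulr_natr mulrAC q_neq0 mul0r.
have [j dj0] := descent_vanishes _ d t dS
  (fun j x => one_sub_nonunit_unit _ x (t_nonunit j)).
have [|r def_r] := fix_sigma (u ^+ (q ^ j)).
  by apply/eqP; rewrite -subr_eq0 rmorphXn; apply/eqP.
exists r; rewrite -def_r mulrBr; apply/eqP; rewrite subr_eq0; apply/eqP.
elim: j {dj0 def_r} => [|j IH]; first by rewrite expr1.
by rewrite expnSr exprM -frobE -[iota e]sigma_fix -rmorphM -IH rmorphM /= sigma_fix.
Qed.

(** * Skew evaluation, right division and residue independence *)

Lemma iter_sigmaM k x y :
  iter k sigma (x * y) = iter k sigma x * iter k sigma y.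
Proof. by elim: k => //= k ->; rewrite rmorphM. Qed.

Lemma iter_sigmaB k x y :
  iter k sigma (x - y) = iter k sigma x - iter k sigma y.
Proof. by elim: k => //= k ->; rewrite rmorphB. Qed.

(** The operator of index k is the k-th iterate of [x |-> sigma x * a]; this peels off the innermost
    application. *)
Lemma DskS a k x : Dsk sigma a k.+1 x = Dsk sigma a k (sigma x * a).
Proof.
by rewrite /Dsk /Nsk big_ord_recr /= -iterS iterSr iter_sigmaM; ring.
Qed.

(* Right division by 'X - c in the skew polynomial ring, read off on values:
   'X - c evaluates at a to the map x |-> sigma x * a - c * x. *)
Lemma skew_division d (f : nat -> S) c :
  exists g r, ((0 < d)%N -> g d.-1 = f d) /\
    forall a x, \sum_(k < d.+1) f k * Dsk sigma a k x =
      \sum_(k < d) g k * Dsk sigma a k (sigma x * a - c * x) + r * x.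
Proof.
elim: d f => [|d IH] f.
  exists f, (f 0); split=> // a x.
  by rewrite big_ord1 big_ord0 add0r /Dsk /Nsk big_ord0 mulr1.
(* Trading the top term for [f d.+1] times the operator of index d at [sigma x * a - c * x] leaves a
   term of index d, absorbed into [f' d]. *)
pose f' k := if k == d then f d + f d.+1 * iter d sigma c else f k.
have [g [r [_ divE]]] := IH f'.
exists (fun k => if k == d then f d.+1 else g k), r.
split=> [_|a x]; first by rewrite eqxx.
have ltF n (k : 'I_n) : (k == n :> nat) = false by rewrite ltn_eqF.
rewrite big_ord_recr /= [in RHS]big_ord_recr /= eqxx.
under [in RHS]eq_bigr => k _ do rewrite ltF.
have -> : \sum_(k < d.+1) f k * Dsk sigma a k x =
    \sum_(k < d.+1) f' k * Dsk sigma a k x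
    - f d.+1 * iter d sigma c * Dsk sigma a d x.
  rewrite [in LHS]big_ord_recr [in RHS]big_ord_recr /= {2}/f' eqxx.
  under [in RHS]eq_bigr => k _ do rewrite /f' ltF.
  by ring.
rewrite divE; set T := \sum_(k < d) _.
rewrite DskS /Dsk iter_sigmaB !iter_sigmaM mulrBl mulrBr !mulrA.
by rewrite [RHS]addrAC [LHS]addrAC [RHS]addrA.
Qed.

(* Independence over R/m of the residues of s: as e annihilates exactly the
   nonunits, e * c k = 0 says that c k vanishes in R/m. *)
Definition residue_free (s : seq S) :=
  forall c : nat -> R, iota e * (\sum_(k < size s) iota (c k) * s`_k) = 0 ->
  forall k, (k < size s)%N -> e * c k = 0.

Lemma residue_free_map (s : seq S) (a b : S) :
  (forall c : nat -> R,
     let x := \sum_(k < size s) iota (c k) * s`_k in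
     iota e * (sigma x * a - b * x) = 0 ->
     forall k, (k < size s)%N -> e * c k = 0) ->
  residue_free [seq sigma x * a - b * x | x <- s].
Proof.
move=> free_s c sum0 k; rewrite size_map; apply: free_s.
rewrite -[RHS]sum0 size_map rmorph_sum mulr_suml mulr_sumr -sumrB; congr (_ * _).
apply: eq_bigr => i _.
by rewrite (nth_map 0) // rmorphM /= sigma_fix; ring.
Qed.

Lemma residue_free_head_unit (b : S) (s : seq S) :
  residue_free (b :: s) -> b \is a GRing.unit.
Proof.
move=> free_bs; apply/negPn/negP; rewrite nonunitS => /eqP eb0.
move/eqP: e_neq0; apply; rewrite -(mulr1 e).
apply: (free_bs (fun k => (k == 0%N)%:R) _ 0%N) => //=.
rewrite big_ord_recl /= rmorph1 mul1r big1 ?addr0 // => i _.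
by rewrite rmorph0 mul0r.
Qed.

(** * Kernels modulo M of the shift maps attached to a root *)

Section Conjugates.
Variables (a b : S).
Hypotheses (aU : a \is a GRing.unit) (bU : b \is a GRing.unit).

(** With u = x / b, the shift of x is (sigma u - u) * sigma b * a, so u is fixed by sigma modulo M
    and [sigma_fixed_mod] applies. *)
Lemma shift_kernel_same x :
  iota e * (sigma x * a - sconj sigma a b * x) = 0 ->
  exists r, iota e * (x - iota r * b) = 0.
Proof.
move=> ker_x; have [|r ur] := sigma_fixed_mod (x / b).
  have sbU : sigma b * a \is a GRing.unit by rewrite unitrM aU rmorph_unit.
  have -> : iota e * (sigma (x / b) - x / b) =
      iota e * (sigma x * a - sconj sigma a b * x) / (sigma b * a).
    apply: (canRL (mulrK sbU)).
    have -> : sigma x = sigma (x / b) * sigma b by rewrite -rmorphM divrK.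
    by rewrite /sconj; ring.
  by rewrite ker_x mul0r.
by exists r; rewrite -{1}(divrK bU x) -mulrBl mulrA ur mul0r.
Qed.

(** If x were a unit, dividing the relation by the unit sigma b * x / b would make a congruent to
    the conjugate of a' by x / b. *)
Lemma shift_kernel_other a' x :
  (forall y, y \is a GRing.unit -> a - sconj sigma a' y \is a GRing.unit) ->
  iota e * (sigma x * a' - sconj sigma a b * x) = 0 -> iota e * x = 0.
Proof.
move=> sepU ker_x; apply/eqP; rewrite -nonunitS; apply/negP => xU.
have := sepU (x / b); rewrite unitrM unitrV xU bU => /(_ isT).
apply/negP; rewrite nonunitS /sconj rmorphM rmorphV // invrM ?unitrV // invrK.
have sbU : sigma b \is a GRing.unit by rewrite rmorph_unit.
have := congr1 (fun z => - z * ((sigma b)^-1 * b * x^-1)) ker_x.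
rewrite /= oppr0 mul0r /sconj => <-; apply/eqP.
transitivity (iota e * (a * ((sigma b / sigma b) * (b / b) * (x / x))
    - sigma x / sigma b * a' * (b / x))); last by ring.
by rewrite !divrr ?mulr1 1?[b / x]mulrC // ; ring.
Qed.
End Conjugates.

(** The lists need not exhaust the roots, so the induction can pass to their images. Separation is
    assumed for both orders of i and j because the root divided out may sit at any index. *)
Lemma skew_roots_bound l (a : 'I_l -> S) :
  (forall i, a i \is a GRing.unit) ->
  (forall i j, i != j -> forall y, y \is a GRing.unit ->
     a i - sconj sigma (a j) y \is a GRing.unit) ->
  forall d (f : nat -> S) (s : 'I_l -> seq S), f d = 1 ->
  (forall i, residue_free (s i)) ->
  (forall i x, x \in s i ->
     iota e * (\sum_(k < d.+1) f k * Dsk sigma (a i) k x) = 0) ->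
  (\sum_(i < l) size (s i) <= d)%N.
Proof.
move=> aU sepU; elim=> [|d IH] f s fd free_s root_s.
  rewrite big1 // => i _; move: (free_s i) (root_s i).
  case: (s i) => // b t /residue_free_head_unit bU /(_ b (mem_head _ _)).
  rewrite big_ord1 fd /Dsk /Nsk big_ord0 !mulr1 mul1r /= => /eqP.
  by rewrite -nonunitS bU.
case: (altP (@forallP _ (fun i => size (s i) == 0%N))) => [s0|].
  by rewrite big1 // => i _; apply/eqP.
rewrite negb_forall => /existsP [i]; case def_si: (s i) => [|b t] // _.
have free_i : residue_free (b :: t) by rewrite -def_si.
have bU := residue_free_head_unit _ _ free_i.
have [g [r [/(_ isT) g_lead divE]]] := skew_division d.+1 f (sconj sigma (a i) b).
(* The shift kills b, so only r * b remains of the value at b, and b is a unit. *)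
have er0 : iota e * r = 0.
  have := root_s i b; rewrite def_si mem_head => /(_ isT).
  rewrite divE /sconj divrK // subrr big1 => [|k _].
    by rewrite add0r mulrA => erb0; apply: (mulIr bU); rewrite mul0r.
  have -> : Dsk sigma (a i) k 0 = 0.
    by rewrite /Dsk -{1}(subrr b) iter_sigmaB subrr mul0r.
  by rewrite mulr0.
pose s' j := [seq sigma x * a j - sconj sigma (a i) b * x
             | x <- if j == i then t else s j].
have -> : (\sum_(j < l) size (s j) = (\sum_(j < l) size (s' j)).+1)%N.
  rewrite (bigD1 i) //= [in RHS](bigD1 i) //= def_si /s' eqxx size_map /= addSn.
  congr (_ + _).+1; apply: eq_bigr => j ne_ji.
  by rewrite (negPf ne_ji) size_map.
rewrite ltnS; apply: (IH g) => // [|j|j _ /mapP [x x_in ->]].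
- by rewrite g_lead.
- rewrite /s'; case: (eqVneq j i) => [->|ne_ji]; apply: residue_free_map => c x.
    move=> /(shift_kernel_same _ _ (aU i) bU) [u x_ub] k lt_k.
    (* A combination of [t] in the kernel is u * b modulo M: a relation on [b :: t] with coefficient
       -u at b. *)
    apply: (free_i (fun k => if k is k'.+1 then c k' else - u) _ k.+1) => //.
    rewrite /= big_ord_recl /= -[RHS]x_ub rmorphN mulNr addrC.
    by congr (_ * (_ - _)); apply: eq_bigr.
  move=> ker_x; apply: (free_s j).
  apply: (shift_kernel_other _ _ bU _ _ _ ker_x).
  by apply: sepU; rewrite eq_sym.
have x_j : x \in s j.
  move: x_in; case: (eqVneq j i) => // ->; rewrite def_si in_cons => ->.
  by rewrite orbT.
have := root_s j x x_j; rewrite divE mulrDr mulrA er0 mul0r addr0.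
by [].
Qed.
End SkewRoots.

(** Take a largest independent set: a relation modulo M with coefficients [c k] becomes, after
    multiplication by e, an exact relation with coefficients [e * c k]. *)
Lemma frk_residue_free (R S : finComUnitRingType) (iota : {rmorphism R -> S})
    (e : R) (A : {set S}) :
  (forall c : R, (c \isn't a GRing.unit) = (e * c == 0)) ->
  exists s : seq S,
    [/\ residue_free R S iota e s, {subset s <= A} & frk iota A = size s].
Proof.
move=> nonunitR.
have [|B] := @eq_bigmax_cond _
    [pred B : {set S} | (B \subset A) && R_lin_indep iota B] (fun B => #|B|).
  apply/card_gt0P; exists set0; rewrite inE sub0set; apply/forallP => c.
  by apply/implyP => _; apply/forallP => b; rewrite inE.
rewrite inE => /andP [sBA /forallP indB] frkE; exists (enum B); split.
- move=> c sum0 k lt_k.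
  have /implyP := indB [ffun b => e * c (index b (enum B))].
  have -> : \sum_(b in B) iota ([ffun b => e * c (index b (enum B))] b) * b = 0.
    rewrite -[RHS]sum0 -big_enum (big_nth 0) big_mkord mulr_sumr.
    apply: eq_bigr => i _.
    by rewrite ffunE index_uniq ?enum_uniq // rmorphM mulrA.
  rewrite eqxx => /(_ isT) /forallP /(_ (nth 0 (enum B) k)) /implyP.
  rewrite -mem_enum mem_nth // => /(_ isT) /eqP.
  by rewrite ffunE index_uniq ?enum_uniq.
- by move=> b; rewrite mem_enum; apply/subsetP.
- by rewrite -cardE -frkE.
Qed.

Theorem theorem1
  (R S : finComUnitRingType) (iota : {rmorphism R -> S})
  (h : {poly R}) (m : nat) (xi : S) (sigma : {rmorphism S -> S})
  (l : nat) (a : 'I_l -> S) (F : {poly S}) :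
  (* R is a finite commutative chain ring *)
  chain_ring R ->
  (* R ⊆ S *)
  injective iota ->
  (* h monic of degree m, irreducible modulo m *)
  h \is monic -> size h = m.+1 -> (0 < m)%N -> irred_mod h ->
  (* S = R[x]/(h): xi is a root of h and 1, xi, ..., xi^(m-1) is an R-basis *)
  root (map_poly iota h) xi ->
  (forall s : S, exists c : 'I_m -> R, s = \sum_(i < m) iota (c i) * xi ^+ i) ->
  (forall c : 'I_m -> R, \sum_(i < m) iota (c i) * xi ^+ i = 0 ->
     forall i, c i = 0) ->
  (* sigma: R-algebra automorphism of S with fixed ring R, generating Gal(S/R),
     reducing to the q-Frobenius modulo M *)
  bijective sigma ->
  (forall r, sigma (iota r) = iota r) ->
  (forall s, sigma s = s -> exists r, s = iota r) ->
  (forall tau : {rmorphism S -> S}, bijective tau ->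
     (forall r, tau (iota r) = iota r) ->
     exists k, forall s, tau s = iter k sigma s) ->
  (forall y : S, sigma y - y ^+ resq R \in MaxId S) ->
  (* hypotheses on a_1, ..., a_l *)
  (forall i, a i \is a GRing.unit) ->
  (forall i j : 'I_l, (i < j)%N -> forall beta : S, beta \is a GRing.unit ->
     a i - sconj sigma (a j) beta \is a GRing.unit) ->
  (* F non-zero monic skew polynomial *)
  F \is monic ->
  (\sum_(i < l)
     frk iota [set beta : S | skew_eval sigma F (a i) beta \in MaxId S] <=
   (size F).-1)%N.

Proof.
move=> chR iota_inj h_monic size_h m_gt0 h_irr h_root span _ _ sigma_fix fix_sigma
  _ frob aU sepU F_monic.
have [p pNU p_gen] := chain_ring_uniformizer R chR.
have [n pn0 e_neq0] := uniformizer_socle R p pNU p_gen.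
set e := p ^+ n in e_neq0.
have nonunitR (c : R) : (c \isn't a GRing.unit) = (e * c == 0).
  apply/idP/eqP => [/p_gen [z ->]|ec0].
    by rewrite mulrA -exprSr pn0 mul0r.
  by apply: contra_neqN e_neq0 => cU; apply: (mulIr cU); rewrite mul0r.
have nonunitS (s : S) : (s \isn't a GRing.unit) = (iota e * s == 0).
  apply/idP/eqP => [sNU|es0]; last first.
    apply: contra_neqN e_neq0 => sU; apply: iota_inj; rewrite rmorph0.
    by apply: (mulIr sU); rewrite mul0r.
  have [c def_s] := span s.
  case: m m_gt0 size_h c def_s {span} => // m _ size_h c def_s.
  pose f := \poly_(i < m.+1) c (inord i).
  have eval_f : (map_poly iota f).[xi] = s.
    rewrite def_s /f poly_def rmorph_sum horner_sum; apply: eq_bigr => i _.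
    by rewrite /= map_polyZ map_polyXn hornerZ hornerXn inord_val.
  have [i|t eval_ft] := nonunit_coefs_eval _ _ iota xi p p_gen f.
    (* A unit coefficient of [f] would make s = f(xi) a unit; hence all coefficients lie in m and p
       divides s. *)
    apply: contraNN sNU => fiU.
    apply: (unit_coef_eval_unit _ _ iota h xi p n.+1 _ _ _ _ _ _ f) => //.
    - by rewrite size_h ltnS size_poly.
    - by exists i.
    - by exists 1, 0; rewrite eval_f mulr1 mulr0 addr0.
  by rewrite -eval_f eval_ft mulrA -rmorphM -exprSr pn0 rmorph0 mul0r.
have sepU' i j : i != j -> forall y, y \is a GRing.unit ->
    a i - sconj sigma (a j) y \is a GRing.unit.
  move=> ne_ij y yU; case: (ltngtP i j) => [lt_ij|lt_ji|/ord_inj eq_ij].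
  - exact: sepU.
  (* Conjugacy is symmetric: conjugating by the inverse of y swaps the two indices up to a unit
     factor. *)
  - have := sepU j i lt_ji y^-1; rewrite unitrV => /(_ yU).
    have syU : sigma y \is a GRing.unit by rewrite rmorph_unit.
    suff -> : a i - sconj sigma (a j) y
        = - (sigma y / y) * (a j - sconj sigma (a i) y^-1).
      by move=> unit_ji; rewrite unitrM unitrN unitrM syU unitrV yU.
    rewrite /sconj invrK rmorphV // mulrBr.
    transitivity (a i * ((sigma y / sigma y) * (y / y)) - sigma y * a j / y).
      by rewrite !divrr ?mulr1.
    by ring.
  - by rewrite eq_ij eqxx in ne_ij.
have [s s_spec] := fin_all_exists (fun i =>
  frk_residue_free _ _ iota e
    [set x : S | skew_eval sigma F (a i) x \in MaxId S] nonunitR).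
have size_F : size F = (size F).-1.+1 by apply: polySpred; apply: monic_neq0.
under eq_bigr => i _ do have [_ _ ->] := s_spec i.
apply: (skew_roots_bound _ _ iota sigma e e_neq0 iota_inj nonunitR nonunitS
  sigma_fix fix_sigma frob l a aU sepU' _ (fun k => F`_k)).
- exact/eqP.
- by move=> i; have [] := s_spec i.
- move=> i x x_s; have [_ /(_ x x_s)] := s_spec i.
  by rewrite !inE nonunitS /skew_eval -size_F => /eqP.
Qed.
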